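(* Let $Q\subset\mathbb{R}^n$ be convex and closed, let $f$ be weakly $\beta$-quasiconvex on $Q$ for some $\beta\in(0,1]$, let $X_*\neq\emptyset$ be the set of minimizers of $f$ on $Q$, $f^*=\min_{x\in Q}f(x)$, and suppose that $f$ has a sharp minimum: for some $\alpha>0$, $$f(x)-f^*\ge\alpha\min_{x_*\in X_*}\|x-x_*\|_2\qquad\forall x\in Q.$$ Let $x_0\in Q$ and consider the iterations $$x_{k+1}=Pr_Q\{x_k-h_k\nabla f(x_k)\},\qquad h_k=\frac{\beta(f(x_k)-f^* )}{\|\nabla f(x_k)\|_2^2},\qquad k\ge0,$$ where $\|\nabla f(x_k)\|_2\ne0$ for every $k\ge 0$. Then for every $k\ge0$ $$\min_{x_*\in X_*}\|x_{k+1}-x_*\|_2^2\le\prod_{i=0}^k\left(1-\frac{\alpha^2\beta^2}{\|\nabla f(x_i)\|_2^2}\right)\min_{x_*\in X_*}\|x_0-x_*\|_2^2 .$$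
   Context: $\|\cdot\|_2$ is the Euclidean norm and $Pr_Q$ the Euclidean projection onto $Q$. $f$ is a real-valued function defined on an open set containing $Q$. A subgradient $\nabla f(x)$ means an element of the Clarke subdifferential of $f$ at $x$ (assumed to exist at every point of $Q$); if $f$ is differentiable at $x$, it is the usual gradient. $f$ is called weakly $\beta$-quasiconvex on $Q$ (with respect to minimizers $x_*$) if for every $x\in Q$, every $x_*\in X_*$ and every subgradient $\nabla f(x)$ $$f(x_* )\ge f(x)+\frac1\beta\langle\nabla f(x),x_*-x\rangle .$$ The condition $\nabla f(x_k)\neq0$ is a standing assumption on the method (a zero subgradient means that $x_k$ is already a solution).
   Formalization: Added: for i ≤ k, if x_i is already in X_*, then ‖∇f(x_i)‖₂ ≥ αβ. Without it the claim fails: f=|x|, Q=ℝ, β=1, α=1/2, x_0=1, ∇f(x_1)=1/10 at x_1=0 makes the right side negative for k=1. *)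

(* Defs.v *)
From HB Require Import structures.
From mathcomp Require Import all_boot all_order all_algebra.
From mathcomp Require Import all_classical all_reals all_analysis.
From mathcomp Require Import lra.

Set Implicit Arguments.
Unset Strict Implicit.
Unset Printing Implicit Defensive.

Import Order.TTheory GRing.Theory Num.Theory.
Import numFieldNormedType.Exports.

Local Open Scope classical_set_scope.
Local Open Scope ring_scope.

(* The library norm `|x| on 'rV[R]_n is the sup norm, hence norm2; both norms
   give the same topology and the same differentiable functions. *)
Definition dot (R : realType) (n : nat) (u v : 'rV[R]_n) : R :=
  \sum_(i < n) u 0 i * v 0 i.

Definition norm2 (R : realType) (n : nat) (u : 'rV[R]_n) : R :=
  Num.sqrt (dot u u).

(* An infimum, equal to the minimum as soon as the latter is attained, see
   min_onE. *)
Definition min_on (R : realType) (T : Type) (A : set T) (F : T -> R) : R :=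
  inf (F @` A).

Lemma min_onE (R : realType) (T : Type) (A : set T) (F : T -> R) (a : T) :
  A a -> (forall b, A b -> F a <= F b) -> min_on A F = F a.
Proof.
move=> Aa aP; apply/eqP; rewrite eq_le; apply/andP; split.
  by apply: ge_inf; [exists (F a) => _ [b Ab <-]; exact: aP|exists a].
by apply: lb_le_inf; [exists (F a); exists a|move=> _ [b Ab <-]; exact: aP].
Qed.

Definition minimizers (R : realType) (T : Type) (Q : set T) (f : T -> R) :
  set T := [set x | Q x /\ forall y, Q y -> f x <= f y].

Definition is_projection (R : realType) (n : nat) (Q : set 'rV[R]_n)
    (y p : 'rV[R]_n) : Prop :=
  Q p /\ forall z, Q z -> norm2 (y - p) <= norm2 (y - z).

(* For all sequences y_i -> c in C and t_i -> 0+ there are w_i -> w with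
   y_i + t_i w_i in C, stated with filters. *)
Definition clarke_tangent (R : realType) (V : normedModType R) (C : set V)
    (c : V) : set V :=
  [set w | forall e : R, 0 < e ->
    \forall y \near within C (nbhs c) & t \near 0^'+,
      exists2 w' : V, `|w' - w| < e & C (y + t *: w')].

Definition epigraph (R : realType) (n : nat) (U : set 'rV[R]_n)
    (f : 'rV[R]_n -> R) : set ('rV[R]_n * R) :=
  [set p | U p.1 /\ f p.1 <= p.2].

(* Clarke's subdifferential of a function f which is not assumed to be locally
   Lipschitz: (v, -1) belongs to the normal cone (the polar of the tangent
   cone) of the epigraph of f at (x, f x).  For a locally Lipschitz f this is
   the definition by the generalized directional derivative, see
   clarke_subdifferential_lipschitz. *)
Definition clarke_subdifferential (R : realType) (n : nat) (U : set 'rV[R]_n)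
    (f : 'rV[R]_n -> R) (x : 'rV[R]_n) : set 'rV[R]_n :=
  [set v | forall d s, clarke_tangent (epigraph U f) (x, f x) (d, s) ->
    dot v d + (- 1) * s <= 0].

Definition clarke_derivative (R : realType) (n : nat) (f : 'rV[R]_n -> R)
    (x d : 'rV[R]_n) : \bar R :=
  limf_esup (fun p : 'rV[R]_n * R => ((f (p.1 + p.2 *: d) - f p.1) / p.2)%:E)
    (filter_prod (nbhs x) 0^'+).

Lemma clarke_tangent_epigraph (R : realType) (n : nat) (U : set 'rV[R]_n)
    (f : 'rV[R]_n -> R) (x d : 'rV[R]_n) (s : R) :
  open U -> U x ->
  (exists L : R, \forall y \near x & z \near x, `|f y - f z| <= L * `|y - z|) ->
  clarke_tangent (epigraph U f) (x, f x) (d, s) <->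
  (clarke_derivative f x d <= s%:E)%E.
Proof.
move=> oU Ux [L fL].
have [r r0 xr] : exists2 r : R, 0 < r & forall y z, `|x - y| < r ->
    `|x - z| < r -> U y /\ `|f y - f z| <= `|L| * `|y - z|.
  move: fL => [[A B] /= [/nbhs_normP[a a0 aA] /nbhs_normP[b b0 bB]] AB].
  have /nbhs_normP[c c0 cU] : nbhs x U by exact: open_nbhs_nbhs.
  exists (Num.min a (Num.min b c)); first by rewrite !lt_min; apply/and3P.
  move=> y z; rewrite !lt_min => /and3P[ya yb yc] /and3P[za zb zc].
  split; first exact: cU.
  have /= := AB (y, z) (conj (aA _ ya) (bB _ zb)).
  by move=> /le_trans; apply; rewrite ler_wpM2r// ler_norm.
have move_lt y w (t : R) (D : R) : `|x - y| < r / 2 -> 0 < t -> t < r / (2 * D) ->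
    0 < D -> `|w| <= D -> `|x - (y + t *: w)| < r.
  move=> xy t0 tD D0 wD; rewrite opprD addrA (le_lt_trans (ler_normB _ _))//.
  rewrite [ltRHS](splitr r) ltr_leD// normrZ gtr0_norm//.
  rewrite (le_trans (ler_wpM2l (ltW t0) wD))// -ler_pdivlMr//.
  by rewrite -mulrA -invfM ltW.
split=> [T|ds e e0].
- apply/lee_addgt0Pr => e e0.
  pose e' := Num.min 1 (e / (1 + `|L|)).
  have L1 : 0 < 1 + `|L| by rewrite ltr_pwDl.
  have e'0 : 0 < e' by rewrite lt_min ltr01 divr_gt0.
  have [[A B] /= [xA B0] AB] := T _ e'0.
  move: xA; rewrite /within/= => /nbhs_normP[a a0 aA].
  pose D := 1 + `|d|.
  have D0 : 0 < D by rewrite ltr_pwDl.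
  pose rho := Num.min (r / 2) (Num.min a (a / (1 + `|L|))).
  have rho0 : 0 < rho by rewrite !lt_min !divr_gt0// a0.
  pose q := fun p : 'rV[R]_n * R => ((f (p.1 + p.2 *: d) - f p.1) / p.2)%:E.
  pose V := [set p | (q p <= s%:E + e%:E)%E].
  apply: ge_ereal_inf; exists (ereal_sup (q @` V)); last first.
    by apply: ge_ereal_sup => _ [p Vp <-]; exact: Vp.
  exists V => //.
  exists ([set y | `|x - y| < rho], [set t | [/\ B t, 0 < t & t < r / (2 * D)]]).
    split; first by rewrite /= -nbhs_nbhs_norm; exists rho.
    near=> t; split; near: t => //.
      exact: nbhs_right_gt.
    by apply: nbhs_right_lt; rewrite divr_gt0// mulr_gt0.
  move=> [y t] /= []; rewrite !lt_min => /and3P[yr ya yaL] [Bt t0 tD].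
  have yr2 : `|x - y| < r by rewrite (lt_trans yr)// gtr_pMr// invf_lt1// ltr1n.
  have xx : `|x - x| < r by rewrite subrr normr0.
  have [Uy _] := xr _ _ yr2 yr2.
  have [_ fxy] := xr _ _ xx yr2.
  have Ay : A (y, f y).
    apply: aA => //=; rewrite prod_normE/= gt_max ya/=.
    rewrite (le_lt_trans fxy)//.
    rewrite (le_lt_trans (y := (1 + `|L|) * `|x - y|)) ?ler_wpM2r ?lerDr//.
    by rewrite mulrC -ltr_pdivlMr.
  have /= [[d' s'] /= ds' [_ ep]] := AB ((y, f y), t) (conj Ay Bt).
  move: ds'; rewrite prod_normE/= gt_max => /andP[dd' ss'].
  have dD : `|d| <= D by rewrite lerDr.
  have d'D : `|d'| <= D.
    rewrite -(subrK d d') (le_trans (ler_normD _ _))// lerD2r ltW//.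
    by rewrite (lt_le_trans dd')// ge_min lexx.
  have [_ fdd'] := xr _ _ (move_lt _ _ _ _ yr t0 tD D0 dD) (move_lt _ _ _ _ yr t0 tD D0 d'D).
  rewrite /V/= /q/= -EFinD lee_fin ler_pdivrMr//.
  move: fdd'; rewrite opprD addrACA subrr add0r -scalerBr normrZ gtr0_norm// => fdd'.
  have h1 : f (y + t *: d) - f (y + t *: d') <= `|L| * (t * e').
    apply: (le_trans (ler_norm _)); apply: (le_trans fdd').
    by rewrite ler_wpM2l// ler_wpM2l 1?ltW// distrC.
  have h2 : t * s' <= t * (s + e').
    rewrite ler_wpM2l 1?ltW// -lterBDl.
    by rewrite (le_lt_trans (ler_norm _)).
  have h3 : (1 + `|L|) * e' <= e.
    by rewrite mulrC -ler_pdivlMr// ge_min lexx orbT.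
  have h4 : t * ((1 + `|L|) * e') <= t * e by rewrite ler_wpM2l// ltW.
  have {}ep : f (y + t *: d') <= f y + t * s' by [].
  lra.
- have : (clarke_derivative f x d < (s + e)%:E)%E.
    by rewrite (le_lt_trans ds)// lte_fin ltrDl.
  move=> /ereal_inf_lt[_ [V [[A B] /= [xA B0] AB] <-]] Ve.
  pose D := 1 + `|d|.
  have D0 : 0 < D by rewrite ltr_pwDl.
  have [a a0 aA] : exists2 a, 0 < a & ball_ Num.norm x a `<=` A.
    by move/nbhs_normP: xA => [a]; exists a.
  exists ([set p | U p.1 /\ f p.1 <= p.2 /\ A p.1 /\ `|x - p.1| < r / 2],
          [set t | [/\ B t, 0 < t & t < r / (2 * D)]]).
    split.
      rewrite /= /within/= -nbhs_nbhs_norm; exists (Num.min a (r / 2)) => /=.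
        by rewrite lt_min a0 divr_gt0.
      move=> [y u] /=; rewrite prod_normE/= gt_max => /andP[+ _].
      rewrite lt_min => /andP[ya yr] [Uy yu].
      by do !split => //; exact: aA.
    near=> t; split; near: t => //.
      exact: nbhs_right_gt.
    by apply: nbhs_right_lt; rewrite divr_gt0// mulr_gt0.
  move=> [[y u] t] /= [[Uy [fyu [Ay yr]]] [Bt t0 tD]].
  have dD : `|d| <= D by rewrite lerDr.
  have yd := move_lt _ _ _ _ yr t0 tD D0 dD.
  have [Uyd _] := xr _ _ yd yd.
  pose q := (f (y + t *: d) - f y) / t.
  have qe : q < s + e.
    rewrite -lte_fin (le_lt_trans _ Ve)//; apply: ereal_sup_ubound.
    by exists (y, t) => //; apply: (AB (y, t)).
  exists (d, Num.max s q).
    rewrite prod_normE/= subrr normr0 gt_max e0/=.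
    rewrite ger0_norm ?subr_ge0 ?le_max ?lexx//.
    by rewrite ltrBlDl gt_max qe ltrDl e0.
  split => //=.
  have : t * q <= t * Num.max s q by rewrite ler_wpM2l ?(ltW t0)// le_max lexx orbT.
  rewrite {1}/q mulrC divfK ?gt_eqF// => h.
  change (f (y + t *: d) <= u + t * Num.max s q).
  by rewrite (le_trans (y := f y + t * Num.max s q)) ?lerD2r// -lerBlDl.
Unshelve. all: by end_near. Qed.

Lemma clarke_subdifferential_lipschitz (R : realType) (n : nat)
    (U : set 'rV[R]_n) (f : 'rV[R]_n -> R) (x v : 'rV[R]_n) :
  open U -> U x ->
  (exists L : R, \forall y \near x & z \near x, `|f y - f z| <= L * `|y - z|) ->
  clarke_subdifferential U f x v <->
  forall d, ((dot v d)%:E <= clarke_derivative f x d)%E.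
Proof.
move=> oU Ux fL; split=> [vx d|vx d s].
  case E : (clarke_derivative f x d) => [r| |]; last 2 first.
  - by rewrite leey.
  - have /vx : clarke_tangent (epigraph U f) (x, f x) (d, dot v d - 1).
      by apply/clarke_tangent_epigraph => //; rewrite E leNye.
    by rewrite mulN1r opprB addrC subrK ler10.
  have /vx : clarke_tangent (epigraph U f) (x, f x) (d, r).
    by apply/clarke_tangent_epigraph => //; rewrite E.
  by rewrite mulN1r subr_le0 lee_fin.
move/clarke_tangent_epigraph => /(_ oU Ux fL) ds.
by rewrite mulN1r subr_le0 -lee_fin; exact: le_trans (vx d) ds.
Qed.

Definition gradient (R : realType) (n : nat) (f : 'rV[R]_n -> R)
    (x : 'rV[R]_n) : 'rV[R]_n :=
  \row_(j < n) 'D_(delta_mx 0 j) f x.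

(* At a point where f is differentiable but not strictly differentiable the
   Clarke subdifferential may contain more than the gradient; only the gradient
   is then a subgradient. *)
Definition is_subgradient (R : realType) (n : nat) (U : set 'rV[R]_n)
    (f : 'rV[R]_n -> R) (x v : 'rV[R]_n) : Prop :=
  clarke_subdifferential U f x v /\ (differentiable f x -> v = gradient f x).

Definition weakly_quasiconvex (R : realType) (n : nat) (U Q : set 'rV[R]_n)
    (f : 'rV[R]_n -> R) (beta : R) : Prop :=
  forall x xs v, Q x -> minimizers Q f xs -> is_subgradient U f x v ->
    f xs >= f x + beta^-1 * dot v (xs - x).

Definition sharp_minimum (R : realType) (n : nat) (Q : set 'rV[R]_n)
    (f : 'rV[R]_n -> R) (alpha : R) : Prop :=
  forall x, Q x ->
    f x - min_on Q f >= alpha * min_on (minimizers Q f) (fun xs => norm2 (x - xs)).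

(* Main.v *)
Require Import Defs.
From HB Require Import structures.
From mathcomp Require Import all_boot all_order all_algebra.
From mathcomp Require Import all_classical all_reals all_analysis.
From mathcomp Require Import ring lra.

Set Implicit Arguments.
Unset Strict Implicit.
Unset Printing Implicit Defensive.

Import Order.TTheory GRing.Theory Num.Theory.
Import numFieldNormedType.Exports.

Local Open Scope classical_set_scope.
Local Open Scope ring_scope.

(* Projecting onto Q does not increase the distance to a minimizer xs, and
   quasiconvexity gives <g_k, x_k - xs> >= beta (f(x_k) - f_min), so the chosen h_k
   yields
     |x_(k+1) - xs|^2 <= |x_k - xs|^2 - (beta (f(x_k) - f_min))^2 / |g_k|^2;
   the sharp minimum turns the last term into a multiple of the squared distance
   from x_k to the minimizers.  The one-step inequalities can be multiplied
   because their factors are nonnegative: away from the minimizers,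
   Cauchy-Schwarz and quasiconvexity give alpha * beta <= |g_k|.

   Nothing makes the set of minimizers closed, so the distances are handled as
   infima that need not be attained. *)

Section Dot.
Context (R : realType) (n : nat).
Implicit Types (u v w : 'rV[R]_n) (a : R).

Lemma dotC u v : dot u v = dot v u.
Proof. by apply: eq_bigr => i _; rewrite mulrC. Qed.

Lemma dotDl u v w : dot (u + v) w = dot u w + dot v w.
Proof. by rewrite /dot -big_split; apply: eq_bigr => i _; rewrite mxE mulrDl. Qed.

Lemma dotZl a u v : dot (a *: u) v = a * dot u v.
Proof. by rewrite /dot mulr_sumr; apply: eq_bigr => i _; rewrite mxE mulrA. Qed.

Lemma dotNl u v : dot (- u) v = - dot u v.
Proof. by rewrite -scaleN1r dotZl mulN1r. Qed.

Lemma dotDr u v w : dot u (v + w) = dot u v + dot u w.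
Proof. by rewrite dotC dotDl !(dotC u). Qed.

Lemma dotZr a u v : dot u (a *: v) = a * dot u v.
Proof. by rewrite dotC dotZl (dotC v). Qed.

Lemma dotNr u v : dot u (- v) = - dot u v.
Proof. by rewrite dotC dotNl (dotC v). Qed.

Definition dotE := (dotDl, dotDr, dotNl, dotNr, dotZl, dotZr).

Lemma dot_ge0 u : 0 <= dot u u.
Proof. by apply: sumr_ge0 => i _; rewrite -expr2 sqr_ge0. Qed.

Lemma norm2_ge0 u : 0 <= norm2 u.
Proof. exact: sqrtr_ge0. Qed.

Lemma sqr_norm2 u : norm2 u ^+ 2 = dot u u.
Proof. by rewrite sqr_sqrtr ?dot_ge0. Qed.

Lemma norm2_eq0_dot u v : norm2 u = 0 -> dot u v = 0.
Proof.
move=> u0; have /eqP : dot u u = 0 by rewrite -sqr_norm2 u0 expr0n.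
rewrite psumr_eq0 => [/allP uu0|i _]; last by rewrite -expr2 sqr_ge0.
apply: big1 => i _; have := uu0 i (mem_index_enum i).
by rewrite /= mulf_eq0 orbb => /eqP->; rewrite mul0r.
Qed.

Lemma dotB_scale a u v :
  dot (u - a *: v) (u - a *: v) = dot u u - 2 * a * dot u v + a ^+ 2 * dot v v.
Proof. rewrite !dotE (dotC v u); ring. Qed.

Lemma dot_le_norm2 u v : dot u v <= norm2 u * norm2 v.
Proof.
have [u0|u0] := eqVneq (norm2 u) 0.
  by rewrite norm2_eq0_dot// mulr_ge0 ?norm2_ge0.
have [v0|v0] := eqVneq (norm2 v) 0.
  by rewrite dotC norm2_eq0_dot// mulr_ge0 ?norm2_ge0.
have up : 0 < norm2 u by rewrite lt_def u0 norm2_ge0.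
have vp : 0 < norm2 v by rewrite lt_def v0 norm2_ge0.
(* With |.| for [norm2], this square expands to 2 |u| |v| (|u| |v| - <u, v>), and both norms are
   positive here. *)
have := dot_ge0 (norm2 v *: u - norm2 u *: v).
rewrite dotB_scale !dotE -!sqr_norm2 => h.
rewrite -subr_ge0 -(pmulr_rge0 _ (mulr_gt0 up vp)) -(pmulr_rge0 _ (ltr0n R 2)).
by apply: le_trans h _; rewrite le_eqVlt; apply/orP; left; apply/eqP; ring.
Qed.

(* Minimality of [p] along the segment from [p] to [z] gives
   [2 <y - p, z - p> <= t |z - p|^2] for all [t] in [(0, 1]]. *)
Lemma projection_obtuse (Q : set 'rV[R]_n) y p z :
  convex_set (Q : set (convex_lmodType 'rV[R]_n)) ->
  is_projection Q y p -> Q z -> dot (y - p) (z - p) <= 0.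
Proof.
move=> Qc [Qp pmin] Qz; rewrite leNgt; apply/negP => d0.
set d := dot _ _ in d0.
set N := dot (z - p) (z - p).
have N0 : 0 <= N by exact: dot_ge0.
have step t : 0 < t -> t <= 1 -> 2 * d <= t * N.
  move=> t0 t1.
  have Qt : Q (p + t *: (z - p)).
    have := Qc z p (@Itv01 _ t (ltW t0) t1) (mem_set Qz) (mem_set Qp).
    rewrite inE; suff -> : p + t *: (z - p) = t *: z + (1 - t) *: p by [].
    by rewrite scalerBr scalerBl scale1r addrCA.
  have := pmin _ Qt.
  rewrite -(@ler_pXn2r _ 2)// ?nnegrE ?norm2_ge0// !sqr_norm2.
  rewrite opprD addrA dotB_scale -/d -/N => h.
  rewrite -(ler_pM2l t0); lra.
have N1 : 0 < N + d by rewrite ltr_wpDl.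
(* This [t] lies in (0, 1] even when [N] is 0, and turns [step] into 2 (N + d) <= N, absurd for d >
   0. *)
have t0 : 0 < d / (N + d) by rewrite divr_gt0.
have := step _ t0.
rewrite ler_pdivrMr// mul1r lerDr => /(_ N0).
rewrite mulrAC ler_pdivlMr//; nra.
Qed.

(** In y - z = (y - p) + (p - z) the cross term 2 <y - p, p - z> is nonnegative by the obtuse angle
    at [p]. *)
Lemma projection_dist (Q : set 'rV[R]_n) y p z :
  convex_set (Q : set (convex_lmodType 'rV[R]_n)) ->
  is_projection Q y p -> Q z -> norm2 (p - z) ^+ 2 <= norm2 (y - z) ^+ 2.
Proof.
move=> Qc yp Qz; have := projection_obtuse Qc yp Qz.
have -> : y - z = (y - p) + (p - z) by rewrite addrA subrK.
rewrite -(opprB p z) dotNr !sqr_norm2.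
move: (y - p) (p - z) => a b.
rewrite !dotE (dotC b a); have := dot_ge0 a; lra.
Qed.

End Dot.

Section MinOn.
Context (R : realType) (T : Type) (A : set T).
Implicit Types (F : T -> R) (c : R).

(** The bound [c] excludes sets unbounded below, whose [inf] is the default value 0. *)
Lemma min_on_le F c a : (forall b, A b -> c <= F b) -> A a -> min_on A F <= F a.
Proof. by move=> cF Aa; apply: ge_inf; [exists c => _ [b Ab <-]; exact: cF|exists a]. Qed.

Lemma le_min_on F c : A !=set0 -> (forall b, A b -> c <= F b) -> c <= min_on A F.
Proof.
move=> [a Aa] cF; apply: lb_le_inf; first by exists (F a), a.
by move=> _ [b Ab <-]; exact: cF.
Qed.

(** Links sharpness, stated with distances, to squared distances: the square root of the infimum of
    the squares is a lower bound of [F]. *)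
Lemma min_on_sqr_le F : A !=set0 -> (forall b, A b -> 0 <= F b) ->
  min_on A (fun b => F b ^+ 2) <= min_on A F ^+ 2.
Proof.
move=> A0 F0; set m2 := min_on _ _.
have m0 : 0 <= min_on A F by exact: le_min_on.
have m20 : 0 <= m2 by apply: le_min_on => // b _; exact: sqr_ge0.
rewrite -(sqr_sqrtr m20) lerXn2r ?nnegrE ?sqrtr_ge0//.
apply: le_min_on => // b Ab; rewrite -(ger0_norm (F0 _ Ab)) -sqrtr_sqr ler_wsqrtr//.
by apply: (min_on_le (c := 0)) => // c _; exact: sqr_ge0.
Qed.

End MinOn.

Section SubgradientStep.
Context (R : realType) (n : nat).
Implicit Types (U Q : set 'rV[R]_n) (f : 'rV[R]_n -> R) (y v z xs : 'rV[R]_n).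

Lemma quasiconvex_gap U Q f beta y v xs : 0 < beta ->
  weakly_quasiconvex U Q f beta -> Q y -> is_subgradient U f y v ->
  minimizers Q f xs -> beta * (f y - min_on Q f) <= dot v (y - xs).
Proof.
move=> beta0 qc Qy vy xsS; have [Qxs xsmin] := xsS.
rewrite (min_onE Qxs xsmin); have := qc _ _ _ Qy xsS vy.
rewrite -(opprB y xs) dotNr mulrN => h.
rewrite -ler_pdivlMl//; lra.
Qed.

(** With a = beta (f(y) - f_min) <= <v, y - xs>, the step length a / |v|^2 minimizes the bound |y -
    xs|^2 - 2 h a + h^2 |v|^2 over h. *)
Lemma subgradient_step_dist U Q f beta y v z xs :
  convex_set (Q : set (convex_lmodType 'rV[R]_n)) ->
  0 < beta -> weakly_quasiconvex U Q f beta -> Q y ->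
  is_subgradient U f y v -> norm2 v != 0 -> minimizers Q f xs ->
  is_projection Q (y - (beta * (f y - min_on Q f) / norm2 v ^+ 2) *: v) z ->
  norm2 (z - xs) ^+ 2 <=
    norm2 (y - xs) ^+ 2 - (beta * (f y - min_on Q f)) ^+ 2 / norm2 v ^+ 2.
Proof.
move=> Qc beta0 qc Qy vy v0 xsS yz; have [Qxs xsmin] := xsS.
have gap := quasiconvex_gap beta0 qc Qy vy xsS.
apply: (le_trans (projection_dist Qc yz Qxs)); rewrite !sqr_norm2 addrAC.
have v2 : 0 < dot v v by rewrite -sqr_norm2 exprn_gt0// lt_def v0 norm2_ge0.
have f0 : 0 <= f y - min_on Q f by rewrite (min_onE Qxs xsmin) subr_ge0 xsmin.
move: gap; set a := beta * _; set b := y - xs => gap.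
have a0 : 0 <= a by rewrite mulr_ge0// ltW.
rewrite dotB_scale (dotC b v).
have -> : (a / dot v v) ^+ 2 * dot v v = a ^+ 2 / dot v v.
  by rewrite expr_div_n expr2 (expr2 (dot v v)); field; rewrite gt_eqF.
have : a / dot v v * a <= a / dot v v * dot v b.
  by rewrite ler_wpM2l// divr_ge0// ltW.
rewrite mulrAC -expr2; lra.
Qed.

Lemma subgradient_step_contraction U Q f alpha beta y v z :
  convex_set (Q : set (convex_lmodType 'rV[R]_n)) ->
  0 < beta -> weakly_quasiconvex U Q f beta -> minimizers Q f !=set0 ->
  0 < alpha -> sharp_minimum Q f alpha ->
  Q y -> is_subgradient U f y v -> norm2 v != 0 ->
  is_projection Q (y - (beta * (f y - min_on Q f) / norm2 v ^+ 2) *: v) z ->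
  min_on (minimizers Q f) (fun xs => norm2 (z - xs) ^+ 2) <=
    (1 - alpha ^+ 2 * beta ^+ 2 / norm2 v ^+ 2) *
    min_on (minimizers Q f) (fun xs => norm2 (y - xs) ^+ 2).
Proof.
move=> Qc beta0 qc S0 alpha0 sharp Qy vy v0 yz.
have v2 : 0 < norm2 v ^+ 2 by rewrite exprn_gt0// lt_def v0 norm2_ge0.
set D := min_on _ (fun xs => norm2 (y - xs) ^+ 2).
set E := min_on _ _.
set a := beta * (f y - min_on Q f).
(* The decrease does not depend on [xs], so the infimum over [xs] can be taken on both sides. *)
have ED : E + a ^+ 2 / norm2 v ^+ 2 <= D.
  apply: le_min_on => // xs xsS; rewrite -lerBrDr.
  apply: le_trans (subgradient_step_dist Qc beta0 qc Qy vy v0 xsS yz).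
  by apply: (min_on_le (c := 0)) => // *; exact: sqr_ge0.
have aD : (alpha * beta) ^+ 2 * D <= a ^+ 2.
  have dist0 xs : minimizers Q f xs -> 0 <= norm2 (y - xs) by rewrite norm2_ge0.
  have D1 := min_on_sqr_le S0 dist0.
  have d0 := le_min_on S0 dist0.
  have ab0 : 0 <= alpha * beta by rewrite ltW// mulr_gt0.
  apply: (le_trans (ler_wpM2l (sqr_ge0 _) D1)).
  have le_a : alpha * beta * min_on (minimizers Q f) (fun xs => norm2 (y - xs)) <= a.
    by rewrite mulrAC mulrC ler_pM2l//; exact: sharp.
  have a0 := le_trans (mulr_ge0 ab0 d0) le_a.
  by rewrite -exprMn lerXn2r ?nnegrE// mulr_ge0.
have : (alpha * beta) ^+ 2 * D / norm2 v ^+ 2 <= a ^+ 2 / norm2 v ^+ 2.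
  by rewrite ler_pM2r ?invr_gt0.
rewrite mulrAC exprMn mulrBl mul1r; lra.
Qed.

Lemma subgradient_lower_bound U Q f alpha beta y v :
  0 < beta -> weakly_quasiconvex U Q f beta -> minimizers Q f !=set0 ->
  sharp_minimum Q f alpha ->
  Q y -> is_subgradient U f y v -> norm2 v != 0 -> ~ minimizers Q f y ->
  alpha * beta <= norm2 v.
Proof.
move=> beta0 qc S0 sharp Qy vy v0 ynS.
have vp : 0 < norm2 v by rewrite lt_def v0 norm2_ge0.
set D := min_on (minimizers Q f) (fun xs => norm2 (y - xs)).
set a := beta * (f y - min_on Q f).
have aD : a <= norm2 v * D.
  rewrite -ler_pdivrMl//; apply: le_min_on => // xs xsS; rewrite ler_pdivrMl//.
  exact: le_trans (quasiconvex_gap beta0 qc Qy vy xsS) (dot_le_norm2 _ _).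
have a0 : 0 < a.
  have [xs [Qxs xsmin]] := S0.
  rewrite mulr_gt0// (min_onE Qxs xsmin) subr_gt0 ltNge; apply/negP => h.
  by apply: ynS; split => // w Qw; exact: le_trans h (xsmin _ Qw).
(* The positive gap [a] forces D > 0 without closedness of the set of minimizers; [D] then cancels
   in alpha beta D <= a <= |v| D. *)
have D0 : 0 < D by rewrite -(pmulr_rgt0 _ vp); exact: lt_le_trans aD.
rewrite -(ler_pM2r D0); apply: le_trans aD.
by rewrite mulrAC mulrC ler_pM2l//; exact: sharp.
Qed.

End SubgradientStep.

Theorem mainTheorem2 (R : realType) (n : nat) (U Q : set 'rV[R]_n)
    (f : 'rV[R]_n -> R) (alpha beta : R) (x g : nat -> 'rV[R]_n)
    (U_open : open U) (Q_sub_U : Q `<=` U)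
    (Q_convex : convex_set (Q : set (convex_lmodType 'rV[R]_n)))
    (Q_closed : closed Q)
    (subgradient_exists : forall y, Q y -> exists v, is_subgradient U f y v)
    (beta_gt0 : 0 < beta) (beta_le1 : beta <= 1)
    (f_quasiconvex : weakly_quasiconvex U Q f beta)
    (minimizers_nonempty : minimizers Q f !=set0)
    (alpha_gt0 : 0 < alpha)
    (f_sharp : sharp_minimum Q f alpha)
    (x0_in_Q : Q (x 0%N))
    (g_subgradient : forall k : nat, is_subgradient U f (x k) (g k))
    (g_neq0 : forall k : nat, norm2 (g k) != 0)
    (x_step : forall k : nat,
      let h := beta * (f (x k) - min_on Q f) / norm2 (g k) ^+ 2 in
      is_projection Q (x k - h *: g k) (x k.+1)) :
  forall k : nat,
    (* Only iterates that are already minimizers are concerned: there a nonzero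
       subgradient may be shorter than alpha * beta, which makes a factor
       negative and the bound false.  At all other iterates the inequality
       alpha * beta <= norm2 (g i) follows from the other hypotheses. *)
    (forall i : nat, (i <= k)%N -> minimizers Q f (x i) ->
       alpha * beta <= norm2 (g i)) ->
    min_on (minimizers Q f) (fun xs => norm2 (x k.+1 - xs) ^+ 2) <=
    (\prod_(0 <= i < k.+1) (1 - alpha ^+ 2 * beta ^+ 2 / norm2 (g i) ^+ 2)) *
    min_on (minimizers Q f) (fun xs => norm2 (x 0%N - xs) ^+ 2).
Proof.
have Qx k : Q (x k) by case: k => // k; case: (x_step k).
have contr k := subgradient_step_contraction Q_convex beta_gt0 f_quasiconvex
  minimizers_nonempty alpha_gt0 f_sharp (Qx k) (g_subgradient k) (g_neq0 k)
  (x_step k).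
elim=> [_|k IH gS]; first by rewrite big_nat1.
apply: le_trans (contr _) _; rewrite big_nat_recr//= [leRHS]mulrAC [leRHS]mulrC.
have g2 : 0 < norm2 (g k.+1) ^+ 2.
  by rewrite exprn_gt0// lt_def g_neq0 norm2_ge0.
(* [IH] is multiplied by the newest factor, whose nonnegativity amounts to alpha beta <= |g_(k+1)|:
   assumed at a minimizer, derived elsewhere. *)
rewrite ler_wpM2l//; last by apply: IH => i ik; apply: gS; exact: leqW.
rewrite subr_ge0 ler_pdivrMr// mul1r -exprMn.
have ab0 : 0 <= alpha * beta by rewrite ltW// mulr_gt0.
rewrite lerXn2r ?nnegrE ?norm2_ge0//.
have [xS|xnS] := pselect (minimizers Q f (x k.+1)); first exact: gS.
exact: (subgradient_lower_bound beta_gt0 f_quasiconvex minimizers_nonempty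
  f_sharp (Qx _) (g_subgradient _) (g_neq0 _) xnS).
Qed.
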